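(* Let $f,s\in\mathbb{R}$ be two real parameters. For any $k\in\mathbb{N}$, $k\ge 2$, the (normalized) cotangent lift $$\Phi:(z,w)\mapsto\left(q=z^k,\ p=\frac{w}{\overline{z}^{\,k-1}}\right)$$ of the conformal mapping $\mathbb{C}\setminus O\to\mathbb{C}\setminus O$, $z\mapsto q=z^k$, gives the transformation between the two Hamiltonians $$\frac{|w|^2}{2}+f|z|^{2k-2}+s\qquad\text{and}\qquad \frac{|p|^2}{2}+\frac{s}{|q|^{2-2/k}}+f$$ on their zero-energy surfaces, up to time parametrization. In particular, it gives: (i) for $(f>0,s<0)$, $(f<0,s>0)$, or $(f<0,s<0)$, an iso-energetic transformation between two central force systems; in particular, when $k=2$ and $f>0$, $s<0$, between the Hooke system of isotropic harmonic oscillators and the Kepler system in the plane; (ii) for $(f=0,s<0)$ or $(s=0,f<0)$, an iso-energetic transformation between the free motion in the plane with positive energy and some homogeneous central force systems at their energy zero; (iii) for $f=s=0$, a trivial iso-energetic transformation between zero-energy free motions in the plane.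
   Context: $\mathbb{R}^2$ is identified with $\mathbb{C}$, $O$ is the origin, $z,q\in\mathbb{C}\setminus O$ are positions and $w,p\in\mathbb{C}$ the respective conjugate momenta (with canonical one-forms $\operatorname{Re}(\bar w\,dz)$ and $\operatorname{Re}(\bar p\,dq)$). ''Gives the transformation on the zero-energy surfaces, up to time parametrization'' means that $\Phi$ maps the zero level of the first Hamiltonian to the zero level of the second, and carries (unparametrized) orbits of the first Hamiltonian flow on its zero level to orbits of the second on its zero level. ''Iso-energetic'' refers to the correspondence holding on this fixed energy level. *)

(* Defs.v *)
From Stdlib Require Export Reals.
From Coquelicot Require Export Coquelicot.

Open Scope R_scope.

(* Positions and momenta (z, w), as a real normed space; positions are
   restricted to z <> 0 in [energy_level] and [integral_curve]. *)
Definition phase : NormedModule R_AbsRing :=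
  prod_NormedModule R_AbsRing C_R_NormedModule C_R_NormedModule.

Definition dotC (a b : C) : R := Re (Cconj a * b)%C.

(* The symplectic form - d theta, theta = Re (conj w dz).  With this sign,
   iota_X omega = dH reads z' = dH/dw, w' = - dH/dz. *)
Definition omega (X Y : C * C) : R :=
  dotC (snd Y) (fst X) - dotC (snd X) (fst Y).

Definition hamiltonian_vector (H : C * C -> R) (x X : C * C) : Prop :=
  @filterdiff R_AbsRing phase R_NormedModule
    H (@locally phase x) (fun Y => omega X Y).

Definition integral_curve (H : C * C -> R) (a b : R) (c : R -> C * C) : Prop :=
  forall t, a < t < b ->
    fst (c t) <> RtoC 0 /\
    exists X, hamiltonian_vector H (c t) X /\
              @is_derive R_AbsRing phase c t X.

(* [flow H t x y]: the local Hamiltonian flow of H at time t is defined at x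
   and sends x to y. *)
Definition flow (H : C * C -> R) (t : R) (x y : C * C) : Prop :=
  exists (a b : R) (c : R -> C * C),
    a < 0 < b /\ a < t < b /\ integral_curve H a b c /\ c 0 = x /\ c t = y.

(* Unparametrized: the orbit is a subset of phase space. *)
Definition orbit (H : C * C -> R) (x y : C * C) : Prop :=
  exists t, flow H t x y.

Definition energy_level (H : C * C -> R) (e : R) (x : C * C) : Prop :=
  fst x <> RtoC 0 /\ H x = e.

Definition image (F : C * C -> C * C) (A : C * C -> Prop) (y : C * C) : Prop :=
  exists x, A x /\ F x = y.

Definition transforms (F : C * C -> C * C)
    (H1 : C * C -> R) (e1 : R) (H2 : C * C -> R) (e2 : R) : Prop :=
  (forall y, image F (energy_level H1 e1) y <-> energy_level H2 e2 y) /\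
  (forall x, energy_level H1 e1 x ->
     forall y, image F (orbit H1 x) y <-> orbit H2 (F x) y).

(* The nonemptiness clause excludes vacuous correspondences, such as the one
   between the levels -s and -f below when f > 0 and s > 0. *)
Definition isoenergetic_transformation (F : C * C -> C * C)
    (H1 : C * C -> R) (e1 : R) (H2 : C * C -> R) (e2 : R) : Prop :=
  (exists x, energy_level H1 e1 x) /\ transforms F H1 e1 H2 e2.

(* The pull-back of Re (conj p dq) is k Re (conj w dz): the cotangent lift of
   z |-> z^k has p = w / (k conj z^(k-1)), and the factor k is dropped. *)
Definition Phi (k : nat) (x : C * C) : C * C :=
  let (z, w) := x in (Cpow z k, (w / Cpow (Cconj z) (k - 1))%C).

Definition ham1 (f s : R) (k : nat) (x : C * C) : R :=
  let (z, w) := x in Cmod w ^ 2 / 2 + f * Cmod z ^ (2 * k - 2) + s.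

Definition ham2 (f s : R) (k : nat) (x : C * C) : R :=
  let (q, p) := x in Cmod p ^ 2 / 2 + s / Rpower (Cmod q) (2 - 2 / INR k) + f.

Definition mechanical (V : C -> R) (x : C * C) : R :=
  let (z, w) := x in Cmod w ^ 2 / 2 + V z.

Definition pot1 (f : R) (k : nat) (z : C) : R := f * Cmod z ^ (2 * k - 2).

Definition pot2 (s : R) (k : nat) (q : C) : R :=
  s / Rpower (Cmod q) (2 - 2 / INR k).

Definition free_motion : C * C -> R := mechanical (fun _ => 0).

(* Isotropic oscillators, z'' = - 2 f z. *)
Definition hooke (f : R) : C * C -> R := mechanical (fun z => f * Cmod z ^ 2).

(* Attractive for mu > 0. *)
Definition kepler (mu : R) : C * C -> R := mechanical (fun q => - mu / Cmod q).

(* F = - grad V at z. *)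
Definition force (V : C -> R) (z F : C) : Prop :=
  @filterdiff R_AbsRing C_R_NormedModule R_NormedModule
    V (@locally C_R_NormedModule z) (fun h => - dotC F h).

(* The identically zero force is excluded: it is the free motion. *)
Definition central_force (V : C -> R) : Prop :=
  exists phi : R -> R,
    (forall z : C, z <> RtoC 0 ->
       force V z (RtoC (phi (Cmod z)) * (z / RtoC (Cmod z)))%C) /\
    (exists r, 0 < r /\ phi r <> 0).

Definition homogeneous_central_force (V : C -> R) : Prop :=
  central_force V /\
  exists d : R, forall (l : R) (z : C), 0 < l -> z <> RtoC 0 ->
    V (RtoC l * z)%C = Rpower l d * V z.

(* Main.v *)
Require Import Defs.
From Stdlib Require Import Reals Ranalysis5 Lra Lia.
From Coquelicot Require Import Coquelicot.
Open Scope R_scope.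

(** An orbit collects the points reached by integral curves, so for each direction it is enough to
    turn one given curve, on its whole interval around time 0, into a curve of the other system.
    Both directions first produce a curve with velocity [g X], where [g > 0] and [X] is the
    Hamiltonian vector; composing with the inverse of a primitive of [g] then removes the factor.
    The obstacle is the converse: [Phi] is k-to-one, so the lift must start at the prescribed
    preimage and persist along the whole interval. Integrating [q' / q] and exponentiating does both
    at once, with no patching of local branches of the root. Forces are written as a real number
    divided by [Cconj z], and even powers of the modulus as products of powers of [z] and [Cconj z].
    The identities to check thus become rational in [z], [Cconj z] and the momenta, which [field]
    decides. The constants [s] and [f] are moved from the Hamiltonians into the levels [- s] and
    [- f], so that a single statement about [mechanical] yields every clause. *)

(** Along a solution of the first system, [q = z^k] satisfies
    [dq/dt = k z^(k-1) w = k |z|^(2k-2) p], so in the time [tau] with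
    [dtau = k |z|^(2k-2) dt] it satisfies [dq/dtau = p]; using the energy
    relation to eliminate [|w|^2], the terms in [f] cancel in [dp/dtau] and the
    second system remains.  Conversely a solution [(q, p)] is lifted through the
    covering [z |-> z^k] and the same computation is read backwards. *)

Local Notation is_Cderive f t l := (@is_derive R_AbsRing C_R_NormedModule f t l).

(** * Calculus for complex-valued functions of a real variable *)

(** Serves at two levels: [C] as a pair of reals, and [phase] as a pair of complex numbers. *)
Lemma is_derive_pair {U V : NormedModule R_AbsRing} (f : R -> U * V) (t : R) (l : U * V) :
  @is_derive R_AbsRing (prod_NormedModule R_AbsRing U V) f t l <->
  is_derive (fun u => fst (f u)) t (fst l) /\ is_derive (fun u => snd (f u)) t (snd l).
Proof.
  split.
  - intros Hf; split.
    + refine (filterdiff_comp' (U := R_NormedModule)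
        (V := prod_NormedModule R_AbsRing U V) f (fun y => fst y) t _ (fun y => fst y) Hf _).
      apply filterdiff_linear, is_linear_fst.
    + refine (filterdiff_comp' (U := R_NormedModule)
        (V := prod_NormedModule R_AbsRing U V) f (fun y => snd y) t _ (fun y => snd y) Hf _).
      apply filterdiff_linear, is_linear_snd.
  - intros [H1 H2].
    apply (is_derive_ext (V := prod_NormedModule R_AbsRing U V)
             (fun u => (fst (f u), snd (f u)))).
    { intros u; symmetry; apply surjective_pairing. }
    refine (filterdiff_comp'_2 (T := R_NormedModule)
      (W := prod_NormedModule R_AbsRing U V) _ _ (fun a b => (a, b)) t _ _
      (fun a b => (a, b)) H1 H2 _).
    apply (filterdiff_ext _ _ _ (fun y => surjective_pairing y)).
    eapply filterdiff_ext_lin; [apply filterdiff_id | intros y; apply surjective_pairing].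
Qed.

Lemma is_Cderive_coords (f : R -> C) (t : R) (l : C) :
  is_Cderive f t l <->
  is_derive (fun u => fst (f u)) t (fst l) /\ is_derive (fun u => snd (f u)) t (snd l).
Proof. apply (is_derive_pair (U := R_NormedModule) (V := R_NormedModule)). Qed.

Lemma is_derive_eq (f : R -> R) (t l l' : R) :
  is_derive f t l -> l = l' -> is_derive f t l'.
Proof. now intros H <-. Qed.

Lemma is_Cderive_eq (f : R -> C) (t : R) (l l' : C) :
  is_Cderive f t l -> l = l' -> is_Cderive f t l'.
Proof. now intros H <-. Qed.

Lemma is_Cderive_const (a : C) (t : R) : is_Cderive (fun _ => a) t (RtoC 0).
Proof. apply (is_derive_const (V := C_R_NormedModule)). Qed.

Lemma is_Cderive_mult (f g : R -> C) (t : R) (df dg : C) :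
  is_Cderive f t df -> is_Cderive g t dg ->
  is_Cderive (fun u => (f u * g u)%C) t (df * g t + f t * dg)%C.
Proof.
  rewrite !is_Cderive_coords; intros [f1 f2] [g1 g2]; simpl; split.
  - refine (is_derive_eq _ _ _ _ (is_derive_minus _ _ _ _ _
      (Derive.is_derive_mult _ _ _ _ _ f1 g1) (Derive.is_derive_mult _ _ _ _ _ f2 g2)) _).
    unfold minus, plus, opp; simpl; ring.
  - refine (is_derive_eq _ _ _ _ (is_derive_plus _ _ _ _ _
      (Derive.is_derive_mult _ _ _ _ _ f1 g2) (Derive.is_derive_mult _ _ _ _ _ f2 g1)) _).
    unfold plus; simpl; ring.
Qed.

Lemma is_Cderive_conj (f : R -> C) (t : R) (df : C) :
  is_Cderive f t df -> is_Cderive (fun u => Cconj (f u)) t (Cconj df).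
Proof.
  rewrite !is_Cderive_coords; intros [f1 f2]; simpl; split; [exact f1|].
  exact (is_derive_opp _ _ _ f2).
Qed.

Lemma is_Cderive_pow (f : R -> C) (t : R) (df : C) (n : nat) :
  is_Cderive f t df ->
  is_Cderive (fun u => Cpow (f u) (S n)) t (RtoC (INR (S n)) * Cpow (f t) n * df)%C.
Proof.
  intros Hf; induction n as [|n IH].
  - eapply is_Cderive_eq; [apply (is_Cderive_mult _ _ _ _ _ Hf (is_Cderive_const 1 t))|].
    simpl; ring.
  - eapply is_Cderive_eq; [apply (is_Cderive_mult _ _ _ _ _ Hf IH)|].
    rewrite (S_INR (S n)), RtoC_plus; simpl; ring.
Qed.

Lemma is_Cderive_inv (f : R -> C) (t : R) (df : C) :
  is_Cderive f t df -> f t <> RtoC 0 ->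
  is_Cderive (fun u => (/ f u)%C) t (- df / (f t * f t))%C.
Proof.
  intros Hf Hn.
  assert (Hp : fst (f t) ^ 2 + snd (f t) ^ 2 <> 0).
  { intros E; apply Hn; apply injective_projections; simpl in *; nra. }
  rewrite is_Cderive_coords in *; destruct Hf as [f1 f2].
  assert (Hs : is_derive (fun u => fst (f u) ^ 2 + snd (f u) ^ 2) t
            (2 * fst (f t) * fst df + 2 * snd (f t) * snd df)).
  { refine (is_derive_eq _ _ _ _ (is_derive_plus _ _ _ _ _
      (is_derive_pow _ 2 _ _ f1) (is_derive_pow _ 2 _ _ f2)) _).
    unfold plus; simpl; ring. }
  (* Complex division by [f t * f t] unfolds to real division by the squared modulus of that
     product, which is the fourth power of the modulus of [f t]. *)
  assert (Hq : (fst (f t) * fst (f t) - snd (f t) * snd (f t)) ^ 2 +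
     (fst (f t) * snd (f t) + snd (f t) * fst (f t)) ^ 2 <> 0).
  { replace (_ + _) with ((fst (f t) ^ 2 + snd (f t) ^ 2) ^ 2) by ring.
    now apply pow_nonzero. }
  split.
  - refine (is_derive_eq _ _ _ _ (is_derive_div _ _ _ _ _ f1 Hs Hp) _).
    simpl; field; split; intros E; [apply Hq | apply Hp]; rewrite <- E; simpl; ring.
  - refine (is_derive_eq _ _ _ _ (is_derive_div _ _ _ _ _ (is_derive_opp _ _ _ f2) Hs Hp) _).
    unfold opp; simpl; field; split; intros E; [apply Hq | apply Hp]; rewrite <- E; simpl; ring.
Qed.

Lemma is_Cderive_zero_const (f : R -> C) (a b : R) :
  a < 0 < b -> (forall t, a < t < b -> is_Cderive f t (RtoC 0)) ->
  forall t, a < t < b -> f t = f 0.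
Proof.
  intros Hab Hf t Ht.
  destruct (Rtotal_order t 0) as [H|[->|H]]; [|reflexivity|].
  - apply (eq_is_derive (V := C_R_NormedModule)); [|exact H].
    intros u Hu; apply Hf; lra.
  - symmetry; apply (eq_is_derive (V := C_R_NormedModule)); [|exact H].
    intros u Hu; apply Hf; lra.
Qed.

Lemma primitive_on_interval (g : R -> R) (a b : R) :
  a < 0 < b -> (forall t, a < t < b -> continuous g t) ->
  exists G : R -> R, G 0 = 0 /\ forall t, a < t < b -> is_derive G t (g t).
Proof.
  intros Hab Hg; exists (fun t => RInt g 0 t); split.
  { apply (RInt_point (V := R_CompleteNormedModule)). }
  intros t Ht; apply is_derive_RInt with (a := 0); [|now apply Hg].
  apply (locally_interval _ t (Finite a) (Finite b)); simpl; try lra.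
  intros y Hy1 Hy2; apply (RInt_correct (V := R_CompleteNormedModule)).
  apply ex_RInt_continuous; intros z Hz; apply Hg.
  revert Hz; unfold Rmin, Rmax; destruct (Rle_dec 0 y); lra.
Qed.

(** * Lifting curves through z |-> z^k *)

Definition cexp (z : C) : C := (exp (fst z) * cos (snd z), exp (fst z) * sin (snd z)).

Lemma cexp_plus (x y : C) : cexp (x + y)%C = (cexp x * cexp y)%C.
Proof.
  apply injective_projections; simpl; rewrite exp_plus, ?cos_plus, ?sin_plus; ring.
Qed.

Lemma cexp_0 : cexp (RtoC 0) = RtoC 1.
Proof.
  apply injective_projections; simpl; rewrite exp_0, ?cos_0, ?sin_0; ring.
Qed.

Lemma cexp_pow (x : C) (n : nat) : Cpow (cexp x) n = cexp (RtoC (INR n) * x)%C.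
Proof.
  induction n as [|n IH].
  - simpl Cpow; rewrite <- cexp_0; f_equal; simpl INR; ring.
  - simpl Cpow; rewrite IH, <- cexp_plus, S_INR, RtoC_plus; f_equal; ring.
Qed.

Lemma cexp_opp (x : C) : (cexp x * cexp (- x))%C = RtoC 1.
Proof. rewrite <- cexp_plus, <- cexp_0; f_equal; ring. Qed.

Lemma cexp_neq_0 (x : C) : cexp x <> RtoC 0.
Proof.
  intros E; generalize (cexp_opp x); rewrite E, Cmult_0_l; intros H.
  injection H; lra.
Qed.

Lemma is_Cderive_cexp (f : R -> C) (t : R) (df : C) :
  is_Cderive f t df -> is_Cderive (fun u => cexp (f u)) t (df * cexp (f t))%C.
Proof.
  rewrite !is_Cderive_coords; intros [f1 f2]; unfold cexp; simpl.
  assert (He := is_derive_comp exp _ t _ _ (is_derive_exp _) f1).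
  assert (Hc := is_derive_comp cos _ t _ _ (is_derive_cos _) f2).
  assert (Hs := is_derive_comp sin _ t _ _ (is_derive_sin _) f2).
  split.
  - refine (is_derive_eq _ _ _ _ (Derive.is_derive_mult _ _ _ _ _ He Hc) _).
    unfold scal; simpl; unfold mult; simpl; ring.
  - refine (is_derive_eq _ _ _ _ (Derive.is_derive_mult _ _ _ _ _ He Hs) _).
    unfold scal; simpl; unfold mult; simpl; ring.
Qed.

Lemma cexp_surjective (q : C) : q <> RtoC 0 -> exists x, cexp x = q.
Proof.
  intros Hq.
  assert (Hr : 0 < Cmod q) by now apply Cmod_gt_0.
  assert (Hm : Cmod q * Cmod q = fst q * fst q + snd q * snd q).
  { unfold Cmod; rewrite sqrt_sqrt; [ring | nra]. }
  set (r := Cmod q) in *.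
  assert (Ha : fst q = r * (fst q / r)) by (field; lra).
  assert (Hb : snd q = r * (snd q / r)) by (field; lra).
  set (a := fst q / r) in *; set (b := snd q / r) in *.
  assert (Hab : a * a + b * b = 1).
  { rewrite Ha, Hb in Hm; apply (Rmult_eq_reg_l (r * r)); nra. }
  assert (Hs : sqrt (1 - a²) = Rabs b).
  { rewrite <- sqrt_Rsqr_abs; f_equal; unfold Rsqr; lra. }
  (* [acos] returns an angle with nonnegative sine, so the sign of [b] decides between [acos a] and
     its opposite. *)
  assert (Hv : exists v, cos v = a /\ sin v = b).
  { destruct (Rle_dec 0 b) as [Hb0|Hb0].
    - exists (acos a); rewrite cos_acos, sin_acos, Hs by nra.
      split; [reflexivity | now apply Rabs_pos_eq].
    - exists (- acos a); rewrite cos_neg, sin_neg, cos_acos, sin_acos, Hs by nra.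
      split; [reflexivity | rewrite Rabs_left; lra]. }
  destruct Hv as (v & Hc & Hv); exists (ln r, v).
  apply injective_projections; simpl; rewrite exp_ln, ?Hc, ?Hv by assumption; congruence.
Qed.

Lemma Cconj_neq_0 (z : C) : z <> RtoC 0 -> Cconj z <> RtoC 0.
Proof.
  intros Hz E; apply Hz; apply (f_equal Cconj) in E; rewrite Cconj_conj in E; rewrite E.
  apply injective_projections; simpl; ring.
Qed.

Lemma RtoC_INR_S_neq_0 (n : nat) : RtoC (INR (S n)) <> RtoC 0.
Proof. intros E; injection E as E; now apply (not_0_INR (S n)). Qed.

Lemma Cpow_surjective (n : nat) (q : C) :
  q <> RtoC 0 -> exists z, z <> RtoC 0 /\ Cpow z (S n) = q.
Proof.
  intros Hq; destruct (cexp_surjective q Hq) as [x <-].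
  exists (cexp (x / RtoC (INR (S n)))%C); split; [apply cexp_neq_0|].
  rewrite cexp_pow; f_equal; field; apply RtoC_INR_S_neq_0.
Qed.

Lemma is_derive_continuous {V : NormedModule R_AbsRing} (f : R -> V) (t : R) (l : V) :
  is_derive f t l -> continuous f t.
Proof. intros H; apply ex_derive_continuous; now exists l. Qed.

(* The lift is [z0 * exp (L / (n + 1))] with [L] a primitive of [q' / q]. *)
Lemma Cpow_lift (n : nat) (q r : R -> C) (a b : R) (z0 : C) :
  a < 0 < b ->
  (forall t, a < t < b ->
     is_Cderive q t (q t * r t)%C /\ exists l, is_Cderive r t l) ->
  q 0 = Cpow z0 (S n) ->
  exists z : R -> C, z 0 = z0 /\
    forall t, a < t < b ->
      Cpow (z t) (S n) = q t /\ is_Cderive z t (z t * r t / RtoC (INR (S n)))%C.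
Proof.
  intros Hab Hq Hq0.
  destruct (primitive_on_interval (fun t => fst (r t)) a b Hab) as (L1 & L10 & HL1).
  { intros t Ht; destruct (Hq t Ht) as (_ & l & Hl).
    apply is_Cderive_coords in Hl.
    exact (is_derive_continuous (V := R_NormedModule) _ _ _ (proj1 Hl)). }
  destruct (primitive_on_interval (fun t => snd (r t)) a b Hab) as (L2 & L20 & HL2).
  { intros t Ht; destruct (Hq t Ht) as (_ & l & Hl).
    apply is_Cderive_coords in Hl.
    exact (is_derive_continuous (V := R_NormedModule) _ _ _ (proj2 Hl)). }
  set (L := fun t => (L1 t, L2 t) : C).
  assert (HL : forall t, a < t < b -> is_Cderive L t (r t)).
  { intros t Ht; apply is_Cderive_coords; split; [now apply HL1 | now apply HL2]. }
  assert (HL0 : L 0 = RtoC 0) by (unfold L; rewrite L10, L20; reflexivity).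
  assert (Hn := RtoC_INR_S_neq_0 n); set (N := RtoC (INR (S n))) in *.
  exists (fun t => z0 * cexp (L t * / N))%C; split.
  { rewrite HL0, Cmult_0_l, cexp_0; ring. }
  intros t Ht; split.
  - rewrite Cpow_mult_l, cexp_pow, <- Hq0; fold N.
    replace (N * (L t * / N))%C with (L t) by (now field).
    (* Since [q' = q r] and [L' = r], the product [q * cexp (- L)] has zero derivative; this
       replaces any appeal to uniqueness for the linear equation. *)
    assert (E : (q t * cexp (- L t))%C = (q 0 * cexp (- L 0))%C).
    { apply (is_Cderive_zero_const (fun u => q u * cexp (- L u))%C a b); trivial.
      intros u Hu; destruct (Hq u Hu) as (Hd & _).
      eapply is_Cderive_eq.
      - apply is_Cderive_mult; [exact Hd|].
        apply is_Cderive_cexp, (is_derive_opp (V := C_R_NormedModule)), HL, Hu.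
      - change (@opp C_R_NormedModule (r u)) with (- r u)%C; cbv beta; ring. }
    rewrite HL0 in E; replace (- 0)%C with (RtoC 0) in E by ring.
    rewrite cexp_0, Cmult_1_r in E; rewrite <- E.
    rewrite <- Cmult_assoc, (Cmult_comm (cexp _)), cexp_opp; ring.
  - eapply is_Cderive_eq.
    + apply is_Cderive_mult; [apply is_Cderive_const|].
      apply is_Cderive_cexp, is_Cderive_mult; [apply HL, Ht | apply is_Cderive_const].
    + cbv beta; field; exact Hn.
Qed.

(** * Hamiltonian vector fields of mechanical systems *)

Lemma filterdiff_comp_derive {U : NormedModule R_AbsRing} (h : U -> R) (g : R -> R)
    (x : U) (lh : U -> R) (l : R) :
  filterdiff (V := R_NormedModule) h (locally x) lh -> is_derive g (h x) l ->
  filterdiff (V := R_NormedModule) (fun y => g (h y)) (locally x) (fun y => l * lh y).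
Proof.
  intros Hh Hg.
  eapply filterdiff_ext_lin; [exact (filterdiff_comp' h g x lh _ Hh Hg)|].
  intros y; apply Rmult_comm.
Qed.

(** The squared modulus is differentiable at 0 too, unlike [Cmod]; this matters for the kinetic
    term, because the momentum may vanish. *)
Lemma filterdiff_sqr_Cmod (z : C) :
  @filterdiff R_AbsRing C_R_NormedModule R_NormedModule
    (fun y : C => fst y ^ 2 + snd y ^ 2) (@locally C_R_NormedModule z)
    (fun h => 2 * dotC z h).
Proof.
  assert (H1 := filterdiff_comp_derive (U := C_R_NormedModule) (fun y => fst y)
    (fun u => u ^ 2) z (fun y => fst y) (2 * fst z)
    (filterdiff_linear _ (is_linear_fst (U := R_NormedModule) (V := R_NormedModule)))
    ltac:(auto_derive; [trivial | ring])).
  assert (H2 := filterdiff_comp_derive (U := C_R_NormedModule) (fun y => snd y)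
    (fun u => u ^ 2) z (fun y => snd y) (2 * snd z)
    (filterdiff_linear _ (is_linear_snd (U := R_NormedModule) (V := R_NormedModule)))
    ltac:(auto_derive; [trivial | ring])).
  eapply filterdiff_ext_lin; [exact (filterdiff_plus_fct _ _ _ _ H1 H2)|].
  intros y; unfold dotC; simpl; unfold plus; simpl; ring.
Qed.

Lemma Cmod_pow2 (z : C) : Cmod z ^ 2 = fst z ^ 2 + snd z ^ 2.
Proof. unfold Cmod; apply pow2_sqrt; nra. Qed.

Lemma hamiltonian_vector_mechanical (V : C -> R) (z w F : C) :
  force V z F -> hamiltonian_vector (mechanical V) (z, w) (w, F).
Proof.
  intros HV.
  assert (H1 : @filterdiff R_AbsRing phase R_NormedModule (fun x => V (fst x))
             (@locally phase (z, w)) (fun Y => - dotC F (fst Y))).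
  { exact (filterdiff_comp' (U := phase) (V := C_R_NormedModule) (fun x => fst x) V
      (z, w) (fun x => fst x) _ (filterdiff_linear _ is_linear_fst) HV). }
  assert (H2 : @filterdiff R_AbsRing phase R_NormedModule
             (fun x => fst (snd x) ^ 2 + snd (snd x) ^ 2)
             (@locally phase (z, w)) (fun Y => 2 * dotC w (snd Y))).
  { exact (filterdiff_comp' (U := phase) (V := C_R_NormedModule) (fun x => snd x) _
      (z, w) (fun x => snd x) _ (filterdiff_linear _ is_linear_snd)
      (filterdiff_sqr_Cmod w)). }
  assert (H3 := filterdiff_comp_derive (U := phase) _ (fun u => u / 2) (z, w) _ (/ 2) H2
    ltac:(auto_derive; [trivial | field])).
  eapply filterdiff_ext_lin.
  - refine (filterdiff_ext _ _ _ _ (filterdiff_plus_fct _ _ _ _ H3 H1)).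
    intros [y v]; unfold mechanical; rewrite Cmod_pow2; reflexivity.
  - intros Y; unfold omega, dotC; simpl; unfold plus; simpl; field.
Qed.

(** The chain rule, applied to straight lines for uniqueness of the Hamiltonian vector and to
    integral curves for conservation of energy. *)
Lemma hamiltonian_vector_along (H : C * C -> R) (x X : C * C) (c : R -> C * C)
    (t : R) (D : C * C) :
  hamiltonian_vector H x X -> c t = x -> @is_derive R_AbsRing phase c t D ->
  is_derive (fun u => H (c u)) t (omega X D).
Proof.
  intros HX <- Hc.
  eapply filterdiff_ext_lin; [exact (filterdiff_comp' _ _ _ _ _ Hc HX)|].
  intros y; unfold omega, dotC; simpl.
  unfold scal; simpl; unfold prod_scal, scal; simpl; unfold mult; simpl; ring.
Qed.

(** The differential is determined by the derivatives along straight lines, and [omega] is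
    nondegenerate: pairing with four basis vectors reads off the four real coordinates. *)
Lemma hamiltonian_vector_unique (H : C * C -> R) (x X X' : C * C) :
  hamiltonian_vector H x X -> hamiltonian_vector H x X' -> X = X'.
Proof.
  intros HX HX'.
  assert (E : forall Y, omega X Y = omega X' Y).
  { intros Y.
    assert (Hc : @is_derive R_AbsRing phase
              (fun u => @plus phase x (@scal R_AbsRing phase u Y)) 0 Y).
    { assert (H1 := @is_derive_scal_l R_AbsRing phase (fun u => u) 0 _ Y
        (@is_derive_id R_AbsRing 0)).
      assert (H2 := @is_derive_plus R_AbsRing phase _ _ 0 _ _
        (@is_derive_const R_AbsRing phase x 0) H1).
      assert (E : @plus phase zero (@scal R_AbsRing phase one Y) = Y)
        by (rewrite plus_zero_l; apply scal_one).
      exact (eq_rect _ (fun l => @is_derive R_AbsRing phase _ 0 l) H2 _ E). }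
    assert (H0 : @plus phase x (@scal R_AbsRing phase 0 Y) = x).
    { rewrite (@scal_zero_l _ phase); apply (@plus_zero_r phase). }
    rewrite <- (is_derive_unique _ _ _ (hamiltonian_vector_along H x X _ 0 Y HX H0 Hc)).
    exact (is_derive_unique _ _ _ (hamiltonian_vector_along H x X' _ 0 Y HX' H0 Hc)). }
  destruct X as [[a b] [c d]], X' as [[a' b'] [c' d']].
  assert (E1 := E (RtoC 1, RtoC 0)); assert (E2 := E (Ci, RtoC 0)).
  assert (E3 := E (RtoC 0, RtoC 1)); assert (E4 := E (RtoC 0, Ci)).
  unfold omega, dotC in *; simpl in *.
  repeat apply f_equal2; lra.
Qed.

(** Newton's equations. An integral curve only supplies some Hamiltonian vector, and uniqueness
    identifies it with [(w, F z)]. *)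
Lemma integral_curve_mechanical (V : C -> R) (F : C -> C) (a b : R) (c : R -> C * C) :
  (forall z, z <> RtoC 0 -> force V z (F z)) ->
  integral_curve (mechanical V) a b c <->
  forall t, a < t < b ->
    fst (c t) <> RtoC 0 /\
    is_Cderive (fun u => fst (c u)) t (snd (c t)) /\
    is_Cderive (fun u => snd (c u)) t (F (fst (c t))).
Proof.
  intros HF; split; intros Hc t Ht; destruct (Hc t Ht) as [Hz Hd]; split; trivial;
  assert (HX := hamiltonian_vector_mechanical V _ (snd (c t)) _ (HF _ Hz));
  rewrite <- surjective_pairing in HX.
  - destruct Hd as (X & HX' & Hd).
    rewrite (hamiltonian_vector_unique _ _ _ _ HX' HX) in Hd.
    exact (proj1 (is_derive_pair (U := C_R_NormedModule) (V := C_R_NormedModule) _ _ _) Hd).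
  - eexists; split; [exact HX|].
    now apply (is_derive_pair (U := C_R_NormedModule) (V := C_R_NormedModule)).
Qed.

Lemma energy_conservation (H : C * C -> R) (a b : R) (c : R -> C * C) :
  a < 0 < b -> integral_curve H a b c -> forall t, a < t < b -> H (c t) = H (c 0).
Proof.
  intros Hab Hc t Ht.
  assert (Hd : forall u, a < u < b -> is_derive (fun v => H (c v)) u zero).
  { intros u Hu; destruct (Hc u Hu) as (_ & X & HX & HD).
    refine (is_derive_eq _ _ _ _ (hamiltonian_vector_along _ _ _ _ _ _ HX eq_refl HD) _).
    (* [omega] is antisymmetric, so [omega X X = 0]. *)
    unfold omega, dotC; simpl; unfold zero; simpl; ring. }
  destruct (Rtotal_order t 0) as [Hl|[->|Hg]]; [|reflexivity|].
  - apply (eq_is_derive (V := R_NormedModule) (fun v => H (c v))); [|exact Hl].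
    intros u Hu; apply Hd; lra.
  - symmetry; apply (eq_is_derive (V := R_NormedModule) (fun v => H (c v))); [|exact Hg].
    intros u Hu; apply Hd; lra.
Qed.

(** * Additive constants in the Hamiltonians *)

Lemma locally_neq_0 (z : C) :
  z <> RtoC 0 -> @locally C_R_NormedModule z (fun y => y <> RtoC 0).
Proof.
  intros Hz.
  assert (Hc : continuous (U := R_UniformSpace)
             (fun y : C_R_NormedModule => fst y ^ 2 + snd y ^ 2) z).
  { apply (filterdiff_continuous (K := R_AbsRing) (U := C_R_NormedModule) (V := R_NormedModule)).
    eexists; exact (filterdiff_sqr_Cmod z). }
  assert (Hp : 0 < fst z ^ 2 + snd z ^ 2).
  { rewrite <- Cmod_pow2; apply pow_lt, Cmod_gt_0, Hz. }
  eapply filter_imp; [|exact (Hc _ (locally_open _ _ (open_gt 0) (fun y Hy => Hy) _ Hp))].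
  intros y Hy E; change (0 < fst y ^ 2 + snd y ^ 2) in Hy.
  rewrite E in Hy; simpl in Hy; lra.
Qed.

Lemma locally_position_neq_0 (x : C * C) :
  fst x <> RtoC 0 -> @locally phase x (fun y => fst y <> RtoC 0).
Proof.
  intros Hx.
  exact (continuous_fst (U := C_R_NormedModule) (V := C_R_NormedModule)
    (fst x) (snd x) _ (locally_neq_0 _ Hx)).
Qed.

(** The hypothesis is confined to nonzero positions because formulas such as [kepler] and [pot2]
    take unrelated conventional values at the origin; a neighbourhood avoiding the origin suffices
    for the differential. *)
Lemma hamiltonian_vector_shift (H H' : C * C -> R) (e : R) (x X : C * C) :
  (forall y, fst y <> RtoC 0 -> H' y = H y + e) -> fst x <> RtoC 0 ->
  hamiltonian_vector H x X -> hamiltonian_vector H' x X.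
Proof.
  intros HH Hx HX; unfold hamiltonian_vector.
  apply (@filterdiff_ext_locally R_AbsRing phase R_NormedModule (fun y => plus (H y) e)).
  { eapply filter_imp; [|exact (locally_position_neq_0 x Hx)].
    intros y Hy; symmetry; apply HH, Hy. }
  eapply filterdiff_ext_lin.
  - exact (filterdiff_plus_fct (U := phase) _ _ _ _ HX (filterdiff_const e)).
  - intros y; apply plus_zero_r.
Qed.

Lemma orbit_shift (H H' : C * C -> R) (e : R) (x y : C * C) :
  (forall y, fst y <> RtoC 0 -> H' y = H y + e) -> orbit H x y -> orbit H' x y.
Proof.
  intros HH (t & a & b & c & H1 & H2 & Hc & H4); exists t, a, b, c.
  do 2 (split; [assumption|]); split; [|exact H4].
  intros u Hu; destruct (Hc u Hu) as (Hz & X & HX & Hd); split; [exact Hz|].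
  exists X; split; [|exact Hd].
  now apply (hamiltonian_vector_shift H H' e).
Qed.

(** Moves constants between a Hamiltonian and its level. Each orbit equivalence uses [orbit_shift]
    twice, with opposite constants. *)
Lemma transforms_shift (F : C * C -> C * C) (H1 H1' H2 H2' : C * C -> R)
    (e1 e1' e2 e2' : R) :
  (forall y, fst y <> RtoC 0 -> H1' y = H1 y + (e1' - e1)) ->
  (forall y, fst y <> RtoC 0 -> H2' y = H2 y + (e2' - e2)) ->
  transforms F H1 e1 H2 e2 -> transforms F H1' e1' H2' e2'.
Proof.
  intros E1 E2 [Hl Ho].
  assert (L1 : forall x, energy_level H1 e1 x <-> energy_level H1' e1' x).
  { intros x; split; intros [Hx He]; split; trivial; rewrite E1 in * by exact Hx; lra. }
  assert (L2 : forall x, energy_level H2 e2 x <-> energy_level H2' e2' x).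
  { intros x; split; intros [Hx He]; split; trivial; rewrite E2 in * by exact Hx; lra. }
  assert (O1 : forall x y, orbit H1 x y <-> orbit H1' x y).
  { intros x y; split; [now apply orbit_shift with (e1' - e1)|].
    apply orbit_shift with (e1 - e1'); intros z Hz; rewrite E1 by exact Hz; ring. }
  assert (O2 : forall x y, orbit H2 x y <-> orbit H2' x y).
  { intros x y; split; [now apply orbit_shift with (e2' - e2)|].
    apply orbit_shift with (e2 - e2'); intros z Hz; rewrite E2 by exact Hz; ring. }
  split.
  - intros y; rewrite <- L2, <- Hl.
    split; intros (x & Hx & Hy); exists x; split; trivial; now apply L1.
  - intros x Hx y; rewrite <- O2, <- Ho by now apply L1.
    split; intros (x' & Hx' & Hy); exists x'; split; trivial; now apply O1.
Qed.

(** * Change of time *)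

(** [K] inverts the strictly increasing primitive [G] of [g], whence [K' = 1 / g(K)]. The
    construction takes place on a compact subinterval, where the intermediate value theorem and the
    inverse function theorem apply. *)
Lemma inverse_of_primitive (g : R -> R) (a b t : R) :
  a < 0 < b -> a < t < b -> (forall u, a < u < b -> 0 < g u /\ continuous g u) ->
  exists (a1 b1 t1 : R) (K : R -> R),
    a1 < 0 < b1 /\ a1 < t1 < b1 /\ K 0 = 0 /\ K t1 = t /\
    forall u, a1 < u < b1 -> a < K u < b /\ is_derive K u (/ g (K u)).
Proof.
  intros Hab Ht Hg.
  destruct (primitive_on_interval g a b Hab) as (G & G0 & HG).
  { intros u Hu; apply Hg, Hu. }
  assert (Hinc : forall x y, a < x -> x < y -> y < b -> G x < G y).
  { exact (incr_function G (Finite a) (Finite b) g (fun x Hx Hx' => HG x (conj Hx Hx'))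
      (fun x Hx Hx' => proj1 (Hg x (conj Hx Hx')))). }
  (* The compact interval from [a'] to [b'] contains both 0 and [t] in its interior. *)
  assert (Ha : exists a', a < a' /\ a' < 0 /\ a' < t).
  { destruct (Rle_dec 0 t); [exists (a / 2) | exists ((a + t) / 2)]; lra. }
  assert (Hb : exists b', b' < b /\ 0 < b' /\ t < b').
  { destruct (Rle_dec 0 t); [exists ((b + t) / 2) | exists (b / 2)]; lra. }
  destruct Ha as (a' & Ha), Hb as (b' & Hb).
  assert (HdG : forall x, a' <= x <= b' -> derivable_pt_lim G x (g x)).
  { intros x Hx; apply is_derive_Reals, HG; lra. }
  assert (HcG : forall x, a' <= x <= b' -> continuity_pt G x).
  { intros x Hx; apply derivable_continuous_pt; exists (g x); apply HdG, Hx. }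
  (* Guarding the specification by the range makes [K] total; 0 is a placeholder value outside
     it. *)
  assert (HK : forall y, {x | G a' <= y <= G b' -> a' <= x <= b' /\ G x = y}).
  { intros y; destruct (Rle_dec (G a') y) as [H1|H1]; [|exists 0; lra].
    destruct (Rle_dec y (G b')) as [H2|H2]; [|exists 0; lra].
    destruct (f_interv_is_interv G a' b' y) as (x & Hx); [lra | lra | exact HcG |].
    exists x; intros _; exact Hx. }
  pose (K := fun y => proj1_sig (HK y)).
  assert (KP : forall y, G a' <= y <= G b' -> a' <= K y <= b' /\ G (K y) = y)
    by (intros y; exact (proj2_sig (HK y))).
  clearbody K; clear HK.
  assert (Hmon : forall x y, a' <= x -> x < y -> y <= b' -> G x < G y)
    by (intros x y H1 H2 H3; apply Hinc; lra).
  assert (HGab : G a' < G b') by (apply Hmon; lra).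
  assert (KG : forall x, a' <= x <= b' -> K (G x) = x).
  { intros x Hx; destruct (KP (G x)) as [H1 H2].
    { split; [destruct (Req_dec a' x) as [->|]; [|left; apply Hmon]
             |destruct (Req_dec x b') as [->|]; [|left; apply Hmon]]; lra. }
    destruct (Rtotal_order (K (G x)) x) as [H|[H|H]]; [|exact H|].
    - apply Hmon in H; lra.
    - apply Hmon in H; lra. }
  exists (G a'), (G b'), (G t), K.
  assert (G0' : G a' < 0 < G b') by (rewrite <- G0; split; apply Hmon; lra).
  split; [exact G0'|]. split; [split; apply Hmon; lra|].
  split; [rewrite <- G0 at 1; apply KG; lra|]. split; [apply KG; lra|].
  intros u Hu; destruct (KP u) as [Ku GKu]; [lra|].
  split; [lra|].
  assert (Kend : K (G a') <= K u <= K (G b')) by (rewrite !KG; lra).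
  assert (KcP : continuity_pt K u) by (apply (continuity_pt_recip_prelim G K a' b'); trivial; lra).
  assert (Prf : forall x, K (G a') <= x <= K (G b') -> derivable_pt_abs G x (g x)).
  { intros x; rewrite !KG by lra; apply HdG. }
  pose (Prf' := fun x Hx => exist _ (g x) (Prf x Hx) : derivable_pt G x).
  apply is_derive_Reals.
  replace (/ g (K u)) with (1 / derive_pt G (K u) (Prf' (K u) Kend)) by (simpl; unfold Rdiv; ring).
  apply (derivable_pt_lim_recip_interv G K (G a') (G b') u Prf' KcP HGab Hu Kend).
  - intros x Hx; apply KP, Hx.
  - simpl; apply Rgt_not_eq, Hg; lra.
Qed.

(** In [c (K u)] the factor [/ g (K u)] from [K] cancels the factor [g (K u)] in the velocity of
    [c], leaving an integral curve through the same points. *)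
Lemma orbit_of_time_change (H : C * C -> R) (g : R -> R) (c : R -> C * C) (a b t : R) :
  a < 0 < b -> a < t < b ->
  (forall u, a < u < b ->
     fst (c u) <> RtoC 0 /\ 0 < g u /\ continuous g u /\
     exists X, hamiltonian_vector H (c u) X /\
       @is_derive R_AbsRing phase c u (@scal R_AbsRing phase (g u) X)) ->
  orbit H (c 0) (c t).
Proof.
  intros Hab Ht Hc.
  destruct (inverse_of_primitive g a b t Hab Ht)
    as (a1 & b1 & t1 & K & H1 & H2 & K0 & K1 & HK).
  { intros u Hu; destruct (Hc u Hu) as (_ & Hg & Hgc & _); now split. }
  exists t1, a1, b1, (fun u => c (K u)); do 2 (split; [assumption|]).
  split; [|now rewrite K0, K1].
  intros u Hu; destruct (HK u Hu) as [Hku Kd].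
  destruct (Hc _ Hku) as (Hz & Hg & _ & X & HX & Hd).
  split; [exact Hz|]; exists X; split; [exact HX|].
  assert (Hcomp := @is_derive_comp R_AbsRing phase c K u _ _ Hd Kd).
  assert (E : @scal R_AbsRing phase (/ g (K u)) (@scal R_AbsRing phase (g (K u)) X) = X).
  { rewrite scal_assoc; replace (mult _ _) with (@one R_AbsRing); [apply scal_one|].
    unfold mult, one; simpl; field; lra. }
  exact (eq_rect _ (fun l => @is_derive R_AbsRing phase _ u l) Hcomp _ E).
Qed.

(** * Radial power potentials *)

(** The common shape of [pot1] and [pot2] off the origin; a real exponent lets one computation of
    the force serve both. *)
Definition radial_power (a d : R) (z : C) : R := a * Rpower (Cmod z) d.

Lemma force_ext (V V' : C -> R) (z F : C) :
  (forall y, y <> RtoC 0 -> V y = V' y) -> z <> RtoC 0 -> force V z F -> force V' z F.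
Proof.
  intros E Hz; unfold force; apply filterdiff_ext_locally.
  eapply filter_imp; [|exact (locally_neq_0 z Hz)]; exact E.
Qed.

Lemma force_radial_power (a d : R) (z : C) :
  z <> RtoC 0 ->
  force (radial_power a d) z
    (RtoC (- (a * d * Rpower (Cmod z) (d - 1))) * (z / RtoC (Cmod z)))%C.
Proof.
  intros Hz; assert (Hr : 0 < Cmod z) by now apply Cmod_gt_0.
  assert (Hs : 0 < fst z ^ 2 + snd z ^ 2).
  { rewrite <- Cmod_pow2; apply pow_lt, Hr. }
  (* The potential is differentiated as a function of the squared modulus, whose differential is
     known. *)
  assert (Hg : is_derive (fun u => a * Rpower (sqrt u) d) (fst z ^ 2 + snd z ^ 2)
            (a * d * Rpower (Cmod z) (d - 1) * / (2 * Cmod z))).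
  { unfold Rpower; auto_derive.
    - split; [exact Hs | split; [|trivial]]; apply sqrt_lt_R0, Hs.
    - change (sqrt (fst z ^ 2 + snd z ^ 2)) with (Cmod z).
      replace ((d - 1) * ln (Cmod z)) with (d * ln (Cmod z) + - ln (Cmod z)) by ring.
      rewrite exp_plus, exp_Ropp, exp_ln by exact Hr.
      field; lra. }
  refine (filterdiff_ext_lin _ _ _ (filterdiff_comp_derive (U := C_R_NormedModule)
    _ _ z _ _ (filterdiff_sqr_Cmod z) Hg) _).
  intros h; unfold dotC; simpl.
  set (r := Cmod z) in *; clearbody r.
  simpl; field; lra.
Qed.

Lemma central_force_radial_power (a d : R) :
  a <> 0 -> d <> 0 -> central_force (radial_power a d).
Proof.
  intros Ha Hd; exists (fun r => - (a * d * Rpower r (d - 1))); split.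
  - intros z Hz; now apply force_radial_power.
  - exists 1; split; [lra|].
    unfold Rpower; rewrite ln_1, Rmult_0_r, exp_0.
    intros E; apply (Rmult_integral_contrapositive a d); [now split | lra].
Qed.

Lemma central_force_ext (V V' : C -> R) :
  (forall y, y <> RtoC 0 -> V y = V' y) -> central_force V -> central_force V'.
Proof.
  intros E (phi & H1 & H2); exists phi; split; [|exact H2].
  intros z Hz; apply (force_ext V); auto.
Qed.

Lemma homogeneous_radial_power (a d : R) (V : C -> R) :
  (forall y, y <> RtoC 0 -> radial_power a d y = V y) -> a <> 0 -> d <> 0 ->
  homogeneous_central_force V.
Proof.
  intros E Ha Hd; split.
  - now apply (central_force_ext (radial_power a d)), central_force_radial_power.
  - exists d; intros l z Hl Hz; rewrite <- !E; trivial.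
    + unfold radial_power; rewrite Cmod_mult, Cmod_R, Rabs_pos_eq by lra.
      rewrite <- Rpower_mult_distr; [| exact Hl | now apply Cmod_gt_0].
      ring.
    + apply Cmult_neq_0; [|exact Hz].
      intros El; injection El; lra.
Qed.

Lemma pot1_radial_power (f : R) (k : nat) (z : C) :
  z <> RtoC 0 -> radial_power f (INR (2 * k - 2)) z = pot1 f k z.
Proof.
  intros Hz; unfold radial_power, pot1; rewrite Rpower_pow; [reflexivity|].
  now apply Cmod_gt_0.
Qed.

Lemma pot2_radial_power (s : R) (k : nat) (z : C) :
  radial_power s (- (2 - 2 / INR k)) z = pot2 s k z.
Proof. unfold radial_power, pot2; now rewrite Rpower_Ropp. Qed.

(** Euler's relation: the radial derivative times [|z|] is [d * V z], so the force is
    [- d V z / |z|^2], and [z / |z|^2] is the inverse of [Cconj z]. *)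
Lemma force_of_radial_power (a d : R) (V : C -> R) (z : C) :
  (forall y, y <> RtoC 0 -> radial_power a d y = V y) -> z <> RtoC 0 ->
  force V z (RtoC (- (d * V z)) / Cconj z)%C.
Proof.
  intros E Hz; apply (force_ext _ _ _ _ E Hz).
  assert (Hr : 0 < Cmod z) by now apply Cmod_gt_0.
  assert (Hr' : RtoC (Cmod z) <> RtoC 0) by (intros H; injection H; lra).
  replace (RtoC (- (d * V z)) / Cconj z)%C with
    (RtoC (- (a * d * Rpower (Cmod z) (d - 1))) * (z / RtoC (Cmod z)))%C;
    [now apply force_radial_power|].
  assert (Hzb := Cconj_neq_0 z Hz).
  assert (Hm : (RtoC (Cmod z) * RtoC (Cmod z) = z * Cconj z)%C).
  { rewrite <- Cmod2_conj, <- RtoC_mult; f_equal; ring. }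
  assert (Hp : a * d * Rpower (Cmod z) (d - 1) * Cmod z = d * V z).
  { rewrite <- E by exact Hz; unfold radial_power, Rminus.
    rewrite Rpower_plus, Rpower_Ropp, Rpower_1 by exact Hr; field; lra. }
  rewrite <- Hp, !RtoC_opp, !(RtoC_mult _ (Cmod z)).
  set (r := RtoC (Cmod z)) in *; set (P := RtoC (a * d * _)).
  (* The factor [r * r] is inserted so that [Hm] can trade it for [z * Cconj z]. *)
  transitivity (- P * (r * r) / (r * Cconj z))%C; [rewrite Hm|]; field; auto.
Qed.

Lemma orbit_mechanical_of_time_change (V : C -> R) (F : C -> C) (g : R -> R)
    (z w : R -> C) (a b t : R) :
  (forall y, y <> RtoC 0 -> force V y (F y)) ->
  a < 0 < b -> a < t < b ->
  (forall u, a < u < b ->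
     z u <> RtoC 0 /\ 0 < g u /\ (exists l, is_derive g u l) /\
     is_Cderive z u (RtoC (g u) * w u)%C /\ is_Cderive w u (RtoC (g u) * F (z u))%C) ->
  orbit (mechanical V) (z 0, w 0) (z t, w t).
Proof.
  intros HF Hab Ht Hc.
  apply (orbit_of_time_change _ g (fun u => (z u, w u)) a b t Hab Ht).
  intros u Hu; destruct (Hc u Hu) as (Hz & Hg & [l Hl] & H1 & H2).
  do 2 (split; [assumption|]); split.
  { exact (is_derive_continuous (V := R_NormedModule) _ _ _ Hl). }
  exists (w u, F (z u)); split.
  - apply hamiltonian_vector_mechanical, HF, Hz.
  - apply (is_derive_pair (U := C_R_NormedModule) (V := C_R_NormedModule)).
    split; eapply is_Cderive_eq; [exact H1 | | exact H2 | ];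
      apply injective_projections; simpl; unfold scal; simpl; unfold mult; simpl; ring.
Qed.

(** * Powers, [Phi] and the energy relation in terms of z and its conjugate *)

Lemma RtoC_Cmod_pow_even (z : C) (n : nat) :
  RtoC (Cmod z ^ (2 * n)) = (Cpow z n * Cpow (Cconj z) n)%C.
Proof. rewrite pow_mult, RtoC_pow, Cmod2_conj; apply Cpow_mult_l. Qed.

Lemma is_derive_Cmod_pow_even (z : R -> C) (t : R) (dz : C) (n : nat) :
  is_Cderive z t dz -> exists l, is_derive (fun u => Cmod (z u) ^ (2 * n)) t l.
Proof.
  intros Hz; apply is_Cderive_coords in Hz; destruct Hz as [H1 H2].
  eexists; apply (is_derive_ext (fun u => (fst (z u) ^ 2 + snd (z u) ^ 2) ^ n)).
  - intros u; rewrite pow_mult; f_equal; symmetry; apply Cmod_pow2.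
  - apply is_derive_pow.
    exact (is_derive_plus _ _ _ _ _ (is_derive_pow _ 2 _ _ H1) (is_derive_pow _ 2 _ _ H2)).
Qed.

(** The exponent of [pot2] is chosen so that [(n + 1) * (2 - 2 / (n + 1)) = 2 n]: the real power
    becomes a natural one after substituting [q = z^(n+1)]. *)
Lemma pot2_Cpow (s : R) (n : nat) (z : C) :
  z <> RtoC 0 -> pot2 s (S n) (Cpow z (S n)) = s / Cmod z ^ (2 * n).
Proof.
  intros Hz; assert (Hr : 0 < Cmod z) by now apply Cmod_gt_0.
  unfold pot2; f_equal; rewrite Cmod_pow, <- !Rpower_pow, Rpower_mult by exact Hr.
  f_equal; rewrite mult_INR, S_INR; simpl (INR 2); field.
  rewrite <- S_INR; apply not_0_INR; discriminate.
Qed.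

Lemma pot1_S (f : R) (n : nat) (z : C) : pot1 f (S n) z = f * Cmod z ^ (2 * n).
Proof. unfold pot1; do 2 f_equal; lia. Qed.

Lemma Phi_S (n : nat) (z w : C) :
  Phi (S n) (z, w) = (Cpow z (S n), (w / Cpow (Cconj z) n)%C).
Proof. unfold Phi; now replace (S n - 1)%nat with n by lia. Qed.

(** With [r = |z|^n], one has [|p|^2/2 + s/r^2 + f = (|w|^2/2 + f r^2 + s) / r^2]: dividing by [r^2]
    exchanges the constant and the potential, and preserves the zero set. *)
Lemma energy_Phi (f s : R) (n : nat) (z w : C) :
  z <> RtoC 0 ->
  mechanical (pot2 s (S n)) (Phi (S n) (z, w)) = - f <->
  mechanical (pot1 f (S n)) (z, w) = - s.
Proof.
  intros Hz; assert (Hr : 0 < Cmod z) by now apply Cmod_gt_0.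
  rewrite Phi_S; unfold mechanical; rewrite pot2_Cpow, pot1_S by exact Hz.
  rewrite Cmod_div by (apply Cpow_nz, Cconj_neq_0, Hz).
  rewrite Cmod_pow, Cmod_conj, (Nat.mul_comm 2), pow_mult.
  assert (Hp : 0 < Cmod z ^ n) by now apply pow_lt.
  set (r := Cmod z ^ n) in *; clearbody r; set (m := Cmod w); clearbody m.
  assert (K : ((m / r) ^ 2 / 2 + s / r ^ 2) * r ^ 2 = m ^ 2 / 2 + s) by (field; lra).
  split; intros E.
  - rewrite E in K; lra.
  - apply (Rmult_eq_reg_r (r ^ 2)); [rewrite K; lra|].
    apply pow_nonzero; lra.
Qed.

Lemma energy_pot1_complex (f s : R) (n : nat) (z w : C) :
  mechanical (pot1 f (S n)) (z, w) = - s ->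
  (w * Cconj w = - RtoC 2 * RtoC s - RtoC 2 * RtoC f * (Cpow z n * Cpow (Cconj z) n))%C.
Proof.
  unfold mechanical; rewrite pot1_S; intros E.
  rewrite <- RtoC_Cmod_pow_even, <- Cmod2_conj, <- !RtoC_mult, <- RtoC_opp,
    <- RtoC_mult, <- RtoC_minus.
  f_equal; lra.
Qed.

(** * The correspondence of orbits *)

Lemma force_pot1 (f : R) (n : nat) (z : C) :
  z <> RtoC 0 ->
  force (pot1 f (S n)) z
    (RtoC (- (INR (2 * n) * pot1 f (S n) z)) / Cconj z)%C.
Proof.
  apply (force_of_radial_power f).
  replace (2 * n)%nat with (2 * S n - 2)%nat by lia; apply pot1_radial_power.
Qed.

Lemma force_pot2 (s : R) (k : nat) (z : C) :
  z <> RtoC 0 ->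
  force (pot2 s k) z (RtoC (- (- (2 - 2 / INR k) * pot2 s k z)) / Cconj z)%C.
Proof. apply (force_of_radial_power s); intros y _; apply pot2_radial_power. Qed.

Lemma RtoC_force_pot1 (f : R) (n : nat) (z : C) :
  RtoC (- (INR (2 * n) * pot1 f (S n) z)) =
  (- (RtoC 2 * RtoC (INR n) * RtoC f * (Cpow z n * Cpow (Cconj z) n)))%C.
Proof.
  rewrite pot1_S, mult_INR, RtoC_opp, !RtoC_mult, RtoC_Cmod_pow_even.
  replace (INR 2) with 2 by (simpl; ring); ring.
Qed.

Lemma RtoC_force_pot2 (s : R) (n : nat) (z : C) :
  z <> RtoC 0 ->
  RtoC (- (- (2 - 2 / INR (S n)) * pot2 s (S n) (Cpow z (S n)))) =
  (RtoC 2 * RtoC (INR n) / RtoC (INR (S n)) * RtoC s / (Cpow z n * Cpow (Cconj z) n))%C.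
Proof.
  intros Hz; rewrite pot2_Cpow by exact Hz.
  assert (Hr : 0 < Cmod z) by now apply Cmod_gt_0.
  assert (Hp : Cmod z ^ (2 * n) <> 0) by now apply Rgt_not_eq, pow_lt.
  assert (Hn : INR (S n) <> 0) by (apply not_0_INR; discriminate).
  rewrite <- RtoC_Cmod_pow_even, <- RtoC_mult, <- RtoC_div, <- RtoC_mult, <- RtoC_div by assumption.
  f_equal; rewrite S_INR in *; field; auto.
Qed.

(** Writing [k = m + 2] keeps truncated subtraction away: [p] has the power [m + 1] of [Cconj z] in
    its denominator, and its derivative involves the power [m]. *)
Lemma orbit_Phi (f s : R) (m : nat) (x y : C * C) :
  mechanical (pot1 f (S (S m))) x = - s ->
  orbit (mechanical (pot1 f (S (S m)))) x y ->
  orbit (mechanical (pot2 s (S (S m)))) (Phi (S (S m)) x) (Phi (S (S m)) y).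
Proof.
  intros He (t & a & b & c & Hab & Ht & Hc & <- & <-).
  assert (HE := energy_conservation _ _ _ _ Hab Hc); rewrite He in HE.
  assert (Hm := proj1 (integral_curve_mechanical _ _ a b c (fun z => force_pot1 f (S m) z)) Hc).
  clear Hc; rename Hm into Hc.
  rewrite (surjective_pairing (c 0)), (surjective_pairing (c t)), !Phi_S.
  set (z := fun u => fst (c u)) in *; set (w := fun u => snd (c u)) in *.
  apply (orbit_mechanical_of_time_change _ _
    (fun u => INR (S (S m)) * Cmod (z u) ^ (2 * S m))
    (fun u => Cpow (z u) (S (S m))) (fun u => w u / Cpow (Cconj (z u)) (S m))%C
    a b t (force_pot2 s (S (S m))) Hab Ht).
  intros u Hu; destruct (Hc u Hu) as (Hz & Hdz & Hdw).
  change (fst (c u)) with (z u) in *; change (snd (c u)) with (w u) in *.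
  assert (Hr : 0 < Cmod (z u)) by now apply Cmod_gt_0.
  assert (Hzb := Cconj_neq_0 _ Hz).
  split; [now apply Cpow_nz|].
  split; [apply Rmult_lt_0_compat; [apply lt_0_INR; lia | now apply pow_lt]|].
  split.
  { destruct (is_derive_Cmod_pow_even z u _ (S m) Hdz) as [l Hl].
    eexists; apply is_derive_scal, Hl. }
  rewrite RtoC_force_pot1 in Hdw.
  rewrite RtoC_force_pot2, RtoC_mult, RtoC_Cmod_pow_even, Cpow_conj by exact Hz.
  assert (Hw : (w u * Cconj (w u) = - RtoC 2 * RtoC s - RtoC 2 * RtoC f *
             (Cpow (z u) (S m) * Cpow (Cconj (z u)) (S m)))%C).
  { apply energy_pot1_complex; rewrite <- (HE u Hu); f_equal.
    symmetry; apply surjective_pairing. }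
  assert (HN := RtoC_INR_S_neq_0 (S m)).
  assert (Hdb := is_Cderive_pow _ _ _ m (is_Cderive_conj _ _ _ Hdz)).
  assert (HP := Cpow_nz _ m Hz); assert (HB := Cpow_nz _ m Hzb).
  split; eapply is_Cderive_eq.
  - exact (is_Cderive_pow _ _ _ (S m) Hdz).
  - cbv beta; change (fst (c u)) with (z u); change (snd (c u)) with (w u).
    rewrite !Cpow_S; field; auto.
  - refine (is_Cderive_mult _ _ _ _ _ Hdw (is_Cderive_inv _ _ _ Hdb _)).
    now apply Cpow_nz.
  - cbv beta; change (fst (c u)) with (z u); change (snd (c u)) with (w u).
    rewrite !Cpow_S in *.
    set (zu := z u) in *; set (zb := Cconj zu) in *; set (wu := w u) in *.
    set (wb := Cconj wu) in *.
    set (P := Cpow zu m) in *; set (B := Cpow zb m) in *.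
    set (N := RtoC (INR (S (S m)))) in *; set (M := RtoC (INR (S m))).
    (* The derivative of [p] before the energy is used: the force on [w], then the derivative of the
       denominator. Substituting [Hw] cancels the first term and leaves the term in [s]. *)
    transitivity (- (RtoC 2 * M * RtoC f * (zu * P)) / zb - M * (wu * wb) / (zb * zb * B))%C.
    + field; auto.
    + rewrite Hw; field; auto.
Qed.

Lemma Phi_orbit_lift (f s : R) (m : nat) (x : C * C) (y : C * C) :
  fst x <> RtoC 0 -> mechanical (pot1 f (S (S m))) x = - s ->
  orbit (mechanical (pot2 s (S (S m)))) (Phi (S (S m)) x) y ->
  exists x', orbit (mechanical (pot1 f (S (S m)))) x x' /\ Phi (S (S m)) x' = y.
Proof.
  destruct x as [z0 w0]; simpl fst; intros Hz0 He (t & a & b & c & Hab & Ht & Hc & Hc0 & <-).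
  apply energy_Phi in He; [|exact Hz0].
  assert (HE := energy_conservation _ _ _ _ Hab Hc); rewrite Hc0, He in HE.
  assert (Hm := proj1 (integral_curve_mechanical _ _ a b c (force_pot2 s (S (S m)))) Hc).
  clear Hc; rename Hm into Hc.
  rewrite Phi_S in Hc0.
  set (q := fun u => fst (c u)) in *; set (p := fun u => snd (c u)) in *.
  assert (Hr : forall u, a < u < b -> exists l, is_Cderive (fun v => p v * / q v)%C u l).
  { intros u Hu; destruct (Hc u Hu) as (Hq & Hdq & Hdp).
    eexists; exact (is_Cderive_mult _ _ _ _ _ Hdp (is_Cderive_inv _ _ _ Hdq Hq)). }
  (* The logarithmic derivative of [q] is [p / q]; the initial value [z0] selects the right one
     among the k lifts. *)
  destruct (Cpow_lift (S m) q (fun v => p v * / q v)%C a b z0 Hab) as (z & Ez0 & Hlift).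
  { intros u Hu; split; [|now apply Hr]; destruct (Hc u Hu) as (Hq & Hdq & _).
    eapply is_Cderive_eq; [exact Hdq|].
    change (fst (c u)) with (q u) in Hq; change (snd (c u)) with (p u).
    cbv beta; field; exact Hq. }
  { unfold q; now rewrite Hc0. }
  assert (Hz : forall u, a < u < b -> z u <> RtoC 0).
  { intros u Hu E; destruct (Hc u Hu) as [Hq _], (Hlift u Hu) as [Hp _].
    apply Hq; change (fst (c u)) with (q u); rewrite <- Hp, E; simpl; ring. }
  (* The only momentum that [Phi] sends to [p] at the position [z u]. *)
  set (w := fun u => (p u * Cpow (Cconj (z u)) (S m))%C).
  assert (Hcu : forall u, a < u < b -> Phi (S (S m)) (z u, w u) = c u).
  { intros u Hu; rewrite Phi_S, (surjective_pairing (c u)); f_equal.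
    - apply Hlift, Hu.
    - unfold w; change (snd (c u)) with (p u); field.
      apply Cpow_nz, Cconj_neq_0, Hz, Hu. }
  exists (z t, w t); split; [|now apply Hcu].
  assert (Hw0 : w 0 = w0).
  { unfold w, p; rewrite Hc0, Ez0; cbn [snd]; field.
    apply (Cpow_nz _ (S m)), Cconj_neq_0, Hz0. }
  rewrite <- Hw0, <- Ez0.
  (* The factor is the reciprocal of the one in [orbit_Phi]: [z' = p / (k z^(k-1)) = w / (k
     |z|^(2k-2))]. *)
  apply (orbit_mechanical_of_time_change _ _
    (fun u => / (INR (S (S m)) * Cmod (z u) ^ (2 * S m)))
    z w a b t (fun z => force_pot1 f (S m) z) Hab Ht).
  intros u Hu; destruct (Hc u Hu) as (Hq & Hdq & Hdp).
  destruct (Hlift u Hu) as [Hzq Hdz].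
  change (fst (c u)) with (q u) in *; change (snd (c u)) with (p u) in *.
  assert (Hzu := Hz u Hu).
  assert (Hm : 0 < Cmod (z u)) by now apply Cmod_gt_0.
  assert (Hzb := Cconj_neq_0 _ Hzu).
  assert (Hg : 0 < INR (S (S m)) * Cmod (z u) ^ (2 * S m))
    by (apply Rmult_lt_0_compat; [apply lt_0_INR; lia | now apply pow_lt]).
  split; [exact Hzu|].
  split; [now apply Rinv_0_lt_compat|].
  split.
  { destruct (is_derive_Cmod_pow_even z u _ (S m) Hdz) as [l Hl].
    eexists; apply is_derive_inv; [apply is_derive_scal, Hl | lra]. }
  rewrite <- Hzq in Hdp, Hdz.
  rewrite RtoC_force_pot2, Cpow_conj in Hdp by exact Hzu.
  rewrite RtoC_inv, RtoC_mult, RtoC_Cmod_pow_even, RtoC_force_pot1 by lra.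
  (* The lifted pair is not yet known to solve the first system, so its energy is obtained from the
     conserved second energy through [energy_Phi]. *)
  assert (Hw : (w u * Cconj (w u) = - RtoC 2 * RtoC s - RtoC 2 * RtoC f *
             (Cpow (z u) (S m) * Cpow (Cconj (z u)) (S m)))%C).
  { apply energy_pot1_complex, energy_Phi; [exact Hzu|]; now rewrite Hcu, HE. }
  unfold w in Hw |- *; rewrite Cmult_conj, Cpow_conj, Cconj_conj in Hw.
  assert (HN := RtoC_INR_S_neq_0 (S m)).
  assert (HP := Cpow_nz _ m Hzu); assert (HB := Cpow_nz _ m Hzb).
  split; eapply is_Cderive_eq.
  - exact Hdz.
  - cbv beta; rewrite !Cpow_S; field; auto.
  - exact (is_Cderive_mult _ _ _ _ _ Hdp (is_Cderive_pow _ _ _ m (is_Cderive_conj _ _ _ Hdz))).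
  - cbv beta; rewrite !Cdiv_conj, !Cmult_conj, Cinv_conj, !Cpow_conj by
      (try apply Cpow_nz; assumption).
    change (snd (c u)) with (p u).
    rewrite !Cpow_S in *.
    set (zu := z u) in *; set (zb := Cconj zu) in *; set (pu := p u) in *.
    set (pb := Cconj pu) in *.
    set (P := Cpow zu m) in *; set (B := Cpow zb m) in *.
    set (N := RtoC (INR (S (S m)))) in *; set (M := RtoC (INR (S m))).
    replace (Cconj N) with N by (apply injective_projections; simpl; ring).
    (* The second summand is [M] times the squared modulus of [w]; substituting [Hw] now cancels the
       terms in [s] and produces the force of [pot1]. *)
    transitivity ((RtoC 2 * M * RtoC s + M * (pu * (zb * B) * (pb * (zu * P))))
                  / (N * (zu * P) * (zb * B) * zb))%C.
    + field; auto.
    + rewrite Hw; field; auto.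
Qed.

Lemma transforms_mechanical (f s : R) (k : nat) :
  (2 <= k)%nat ->
  transforms (Phi k) (mechanical (pot1 f k)) (- s) (mechanical (pot2 s k)) (- f).
Proof.
  destruct k as [|[|m]]; intros hk; [lia | lia |]; clear hk.
  split.
  - intros [q p]; split.
    + intros ([z w] & [Hz He] & <-); simpl fst in Hz; split.
      * rewrite Phi_S; now apply Cpow_nz.
      * now apply energy_Phi.
    + intros [Hq He]; simpl fst in Hq.
      destruct (Cpow_surjective (S m) q Hq) as (z & Hz & Ez).
      assert (E : Phi (S (S m)) (z, (p * Cpow (Cconj z) (S m))%C) = (q, p)).
      { rewrite Phi_S, Ez; f_equal; field.
        apply (Cpow_nz _ (S m)), Cconj_neq_0, Hz. }
      eexists; split; [|exact E]; split; [exact Hz|].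
      apply energy_Phi; [exact Hz|]; now rewrite E.
  - intros x [Hx He] y; split.
    + intros (x' & Ho & <-); now apply (orbit_Phi f).
    + intros Ho; now apply (Phi_orbit_lift f s).
Qed.

(** * The particular cases *)

Lemma energy_level_nonempty (V : C -> R) (z : C) (e : R) :
  z <> RtoC 0 -> V z <= e -> exists x, energy_level (mechanical V) e x.
Proof.
  intros Hz He; exists (z, RtoC (sqrt (2 * (e - V z)))); split; [exact Hz|].
  unfold mechanical; rewrite Cmod_R, Rabs_pos_eq by apply sqrt_pos.
  rewrite pow2_sqrt; lra.
Qed.

(** A position with potential at most [- s] is enough: close to the origin when [s < 0 < f], far
    from it when [f < 0]. *)
Lemma energy_level_pot1_nonempty (f s : R) (k : nat) :
  (2 <= k)%nat ->
  (0 < f /\ s < 0) \/ f < 0 \/ (f = 0 /\ s <= 0) ->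
  exists x, energy_level (mechanical (pot1 f k)) (- s) x.
Proof.
  intros hk H.
  assert (Hx : exists x, 0 < x /\ f * x ^ (2 * k - 2) <= - s).
  { replace (2 * k - 2)%nat with (S (2 * k - 3)) by lia; set (n := (2 * k - 3)%nat).
    destruct H as [[Hf Hs]|[Hf|[-> Hs]]].
    (* For [x <= 1] one has [x^(n+1) <= x], so the bound [x <= - s / f] suffices; the next case uses
       the reverse inequality for [x >= 1]. *)
    - exists (Rmin 1 (- s / f)).
      assert (Hq : 0 < - s / f) by (apply Rdiv_lt_0_compat; lra).
      assert (Hm : 0 < Rmin 1 (- s / f)) by (apply Rmin_glb_lt; lra).
      split; [exact Hm|].
      assert (Hp : Rmin 1 (- s / f) ^ n <= 1).
      { rewrite <- (pow1 n) at 2; apply pow_incr; split; [lra | apply Rmin_l]. }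
      assert (Hr := Rmin_r 1 (- s / f)).
      assert (E : f * (- s / f) = - s) by (field; lra).
      apply Rle_trans with (2 := Req_le _ _ E), Rmult_le_compat_l; [lra|]; simpl pow.
      apply (Rmult_le_compat_l (Rmin 1 (- s / f))) in Hp; lra.
    - exists (Rmax 1 (s / - f)).
      assert (Hm := Rmax_l 1 (s / - f)); assert (Hr := Rmax_r 1 (s / - f)).
      split; [lra|].
      assert (Hp : 1 <= Rmax 1 (s / - f) ^ n) by now apply pow_R1_Rle.
      assert (E : f * (s / - f) = - s) by (field; lra).
      apply Rle_trans with (2 := Req_le _ _ E), Rmult_le_compat_neg_l; [lra|]; simpl pow.
      apply (Rmult_le_compat_l (Rmax 1 (s / - f))) in Hp; lra.
    - exists 1; lra. }
  destruct Hx as (x & Hx & He).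
  apply (energy_level_nonempty _ (RtoC x)).
  - intros E; injection E; lra.
  - unfold pot1; now rewrite Cmod_R, Rabs_pos_eq by lra.
Qed.

Lemma force_zero (z : C) : force (fun _ => 0) z (RtoC 0).
Proof.
  eapply filterdiff_ext_lin;
    [exact (filterdiff_const (U := C_R_NormedModule) (V := R_NormedModule) 0)|].
  intros h; unfold dotC, zero; simpl; ring.
Qed.

(** Zero kinetic energy forces zero momentum, so every such state is an equilibrium; this is the
    precise sense in which the last case is trivial. *)
Lemma free_motion_orbit_at_rest (x y : C * C) :
  energy_level free_motion 0 x -> orbit free_motion x y <-> y = x.
Proof.
  intros [Hz He].
  assert (Hw : snd x = RtoC 0).
  { apply Cmod_eq_0; destruct x as [z w]; unfold free_motion, mechanical in He; simpl snd.
    generalize (Cmod_ge_0 w); nra. }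
  split.
  - intros (t & a & b & c & Hab & Ht & Hc & <- & <-).
    assert (Hm := proj1 (integral_curve_mechanical _ _ a b c (fun z _ => force_zero z)) Hc).
    assert (Es : forall u, a < u < b -> snd (c u) = RtoC 0).
    { intros u Hu; rewrite <- Hw.
      apply (is_Cderive_zero_const (fun v => snd (c v)) a b Hab); [|exact Hu].
      intros v Hv; apply Hm, Hv. }
    apply injective_projections; [|now rewrite !Es].
    apply (is_Cderive_zero_const (fun v => fst (c v)) a b Hab); [|exact Ht].
    intros v Hv; destruct (Hm v Hv) as (_ & Hd & _); now rewrite Es in Hd.
  - intros ->; exists 0, (-1), 1, (fun _ => x).
    do 2 (split; [lra|]); split; [|now split].
    apply (proj2 (integral_curve_mechanical _ _ _ _ _ (fun z _ => force_zero z))).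
    intros u _; split; [exact Hz|]; rewrite Hw; split; apply is_Cderive_const.
Qed.

Lemma kepler_pot2 (s : R) (y : C * C) :
  fst y <> RtoC 0 -> kepler (- s) y = mechanical (pot2 s 2) y.
Proof.
  destruct y as [q p]; intros Hq; unfold kepler, mechanical, pot2; simpl INR.
  replace (2 - 2 / (1 + 1)) with 1 by field.
  rewrite Rpower_1, Ropp_involutive by (apply Cmod_gt_0, Hq); reflexivity.
Qed.

Theorem theorem2 (f s : R) (k : nat) (hk : (2 <= k)%nat) :
  transforms (Phi k) (ham1 f s k) 0 (ham2 f s k) 0
  /\ ((0 < f /\ s < 0) \/ (f < 0 /\ 0 < s) \/ (f < 0 /\ s < 0) ->
        central_force (pot1 f k) /\ central_force (pot2 s k) /\
        isoenergetic_transformation (Phi k)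
          (mechanical (pot1 f k)) (- s) (mechanical (pot2 s k)) (- f))
  /\ (k = 2%nat -> 0 < f -> s < 0 ->
        isoenergetic_transformation (Phi k)
          (hooke f) (- s) (kepler (- s)) (- f))
  /\ (f = 0 -> s < 0 ->
        homogeneous_central_force (pot2 s k) /\
        isoenergetic_transformation (Phi k)
          free_motion (- s) (mechanical (pot2 s k)) 0)
  /\ (s = 0 -> f < 0 ->
        homogeneous_central_force (pot1 f k) /\
        isoenergetic_transformation (Phi k)
          (mechanical (pot1 f k)) 0 free_motion (- f))
  /\ (f = 0 -> s = 0 ->
        isoenergetic_transformation (Phi k) free_motion 0 free_motion 0 /\
        (forall x, energy_level free_motion 0 x ->
           forall y, orbit free_motion x y <-> y = x)).
Proof.
  assert (T := transforms_mechanical f s k hk).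
  assert (NE := energy_level_pot1_nonempty f s k hk).
  assert (F1 : f = 0 -> forall y, free_motion y = mechanical (pot1 f k) y).
  { intros -> [z w]; unfold free_motion, mechanical, pot1; ring. }
  assert (F2 : s = 0 -> forall y, free_motion y = mechanical (pot2 s k) y).
  { intros -> [q p]; unfold free_motion, mechanical, pot2, Rdiv; ring. }
  (* Both exponents vanish at [k = 1]; [hk] excludes this, so nonzero coefficients give forces that
     are not identically zero. *)
  assert (D1 : INR (2 * k - 2) <> 0) by (apply not_0_INR; lia).
  assert (D2 : - (2 - 2 / INR k) <> 0).
  { assert (H2 : 2 <= INR k) by (apply (le_INR 2) in hk; simpl in hk; lra).
    assert (H3 : 2 / INR k <= 1) by (apply Rle_div_l; lra); lra. }
  assert (E1 := fun y => pot1_radial_power f k y).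
  assert (E2 := fun y (_ : y <> RtoC 0) => pot2_radial_power s k y).
  split; [|split; [|split; [|split; [|split]]]].
  - apply transforms_shift with (3 := T).
    + intros [z w] _; unfold ham1, mechanical, pot1; ring.
    + intros [q p] _; unfold ham2, mechanical, pot2; ring.
  - intros H; split; [|split; [|split; [apply NE; tauto | exact T]]].
    + apply (central_force_ext _ _ E1), central_force_radial_power; [lra | exact D1].
    + apply (central_force_ext _ _ E2), central_force_radial_power; [lra | exact D2].
  - intros -> Hf Hs; split; [apply NE; tauto|].
    apply transforms_shift with (3 := T).
    + intros y _; change (hooke f y) with (mechanical (pot1 f 2) y); ring.
    + intros y Hy; rewrite kepler_pot2 by exact Hy; ring.
  - intros Hf Hs; split; [apply (homogeneous_radial_power _ _ _ E2); lra|].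
    split.
    + apply (energy_level_nonempty _ (RtoC 1)); [intros E; injection E; lra | lra].
    + apply transforms_shift with (3 := T).
      * intros y _; rewrite F1 by exact Hf; ring.
      * intros y _; rewrite Hf; ring.
  - intros Hs Hf; split; [apply (homogeneous_radial_power _ _ _ E1); [lra | exact D1]|].
    split.
    + replace 0 with (- s) by lra; apply NE; tauto.
    + apply transforms_shift with (3 := T).
      * intros y _; rewrite Hs; ring.
      * intros y _; rewrite F2 by exact Hs; ring.
  - intros Hf Hs; split; [split|].
    + apply (energy_level_nonempty _ (RtoC 1)); [intros E; injection E; lra | lra].
    + apply transforms_shift with (3 := T); intros y _.
      * rewrite F1, Hs by exact Hf; ring.
      * rewrite F2, Hf by exact Hs; ring.
    + intros x Hx y; now apply free_motion_orbit_at_rest.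
Qed.
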